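(* Consider SGD-star with arbitrary sampling (defined in the context) with stepsize $\alpha=n\min_j\frac{p_j}{v_j}$. Then its iteration complexity is $\max_j\left(\frac{v_j}{np_j\sigma}\right)\log\frac1\epsilon$; that is, for every $\epsilon\in(0,1)$ and every integer $k\ge\max_j\left(\frac{v_j}{np_j\sigma}\right)\log\frac1\epsilon$ we have $$\mathbb E\left[\|x^k-x^*\|^2\right]\le\epsilon\,\|x^0-x^*\|^2 .$$
   Context: Problem. $f_1,\dots,f_n:\mathbb R^d\to\mathbb R$ are differentiable and convex, $f=\frac1n\sum_{j=1}^n f_j$, $\psi:\mathbb R^d\to\mathbb R\cup\{+\infty\}$ is proper, closed and convex. $\min_x f(x)+\psi(x)$ has a unique minimizer $x^*$, and $f$ is $\sigma$-quasi strongly convex with $\sigma>0$: $f(x^* )\ge f(y)+\langle\nabla f(y),x^*-y\rangle+\frac\sigma2\|y-x^*\|^2$ for all $y$. Each $f_j$ is $\mathbf M_j$-smooth, $\mathbf M_j\succeq0$ symmetric: $f_j(x)\le f_j(y)+\langle\nabla f_j(y),x-y\rangle+\frac12(x-y)^\top\mathbf M_j(x-y)$ for all $x,y$. $\mathrm{prox}_{\alpha\psi}(x)=\arg\min_u\{\alpha\psi(u)+\frac12\|u-x\|^2\}$. Sampling. $R$ is a random subset of $[n]$ with arbitrary distribution such that $p_j=\mathbb P(j\in R)>0$ for all $j$. The vector $v\in\mathbb R^n$ satisfies $\mathbb E\left[\left\|\sum_{j\in R}\mathbf M_j^{1/2}h_j\right\|^2\right]\le\sum_{j=1}^n p_jv_j\|h_j\|^2$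 for all $h_1,\dots,h_n\in\mathbb R^d$ (with the convention $p_j/v_j=+\infty$ if $v_j=0$). Algorithm (SGD-star; the gradients $\nabla f_j(x^* )$ are assumed known). Given $x^0\in\mathbb R^d$, for $k=0,1,2,\dots$: draw $R^k$, a copy of $R$ independent of the past; $g^k=\frac1n\sum_{j=1}^n\nabla f_j(x^* )+\sum_{j\in R^k}\frac1{np_j}\left(\nabla f_j(x^k)-\nabla f_j(x^* )\right)$; $x^{k+1}=\mathrm{prox}_{\alpha\psi}(x^k-\alpha g^k)$. *)

(* Defs.v *)
From HB Require Import structures.
From mathcomp Require Export all_boot all_order all_algebra.
From mathcomp Require Export all_classical all_reals all_analysis.
Export Order.TTheory GRing.Theory Num.Theory.
Export numFieldNormedType.Exports.

Set Implicit Arguments.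
Unset Strict Implicit.
Unset Printing Implicit Defensive.

Local Open Scope classical_set_scope.
Local Open Scope ring_scope.

Section Vectors.
Variables (R : realType) (d : nat).
Implicit Types (x y : 'cV[R]_d) (A B M : 'M[R]_d) (f : 'cV[R]_d -> R).

Definition dot x y : R := \sum_(i < d) x i 0 * y i 0.

(* Squared Euclidean norm; the library norm on matrices is the sup norm. *)
Definition sqnorm x : R := dot x x.

Definition sympsd M : Prop := M^T = M /\ forall x, 0 <= dot x (M *m x).

(* The (unique) symmetric positive semidefinite square root of M; arbitrary
   if M is not symmetric positive semidefinite. *)
Definition sqrtmx M : 'M[R]_d := get [set B | sympsd B /\ B *m B = M].

Definition grad f x : 'cV[R]_d := \col_(i < d) 'D_(delta_mx i 0) f x.

Definition matrix_smooth f M : Prop := forall x y,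
  f x <= f y + dot (grad f y) (x - y) + 2^-1 * dot (x - y) (M *m (x - y)).

Definition quasi_strongly_convex f (xs : 'cV[R]_d) (sigma : R) : Prop :=
  forall y, f xs >= f y + dot (grad f y) (xs - y) + sigma / 2 * sqnorm (y - xs).

End Vectors.

Section ExtendedFunctions.
Variables (R : realType) (d : nat).
Implicit Types (x y u : 'cV[R]_d) (F psi : 'cV[R]_d -> \bar R).
Local Open Scope ereal_scope.

(* psi takes values in R `|` {+oo} and is not identically +oo. *)
Definition proper_function psi : Prop :=
  (forall x, psi x != -oo) /\ exists x, psi x != +oo.

Definition closed_function psi : Prop :=
  closed [set z : 'cV[R]_d * R | psi z.1 <= z.2%:E].

Definition econvex psi : Prop := forall x y (t : R), (0 < t < 1)%R ->
  psi (t *: x + (1 - t) *: y)%R <= t%:E * psi x + (1 - t)%:E * psi y.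

Definition argmin F : set 'cV[R]_d := [set x | forall y, F x <= F y].

(* The argmin is a singleton when psi is proper, closed and convex and
   0 < alpha. *)
Definition prox (alpha : R) psi x : 'cV[R]_d :=
  get (argmin (fun u => alpha%:E * psi u + (2^-1 * sqnorm (u - x))%:E)).

End ExtendedFunctions.

Section Sampling.
Variables (dT : measure_display) (T : measurableType dT) (R : realType).
Variables (P : probability T R) (n : nat).
Implicit Types S : T -> {set 'I_n}.

Definition random_set S : Prop :=
  forall A : {set 'I_n}, measurable [set w | S w = A].

Definition same_law S S' : Prop :=
  forall A : {set 'I_n}, P [set w | S w = A] = P [set w | S' w = A].

(* S k is independent of (S 0, ..., S (k - 1)); as the range is finite, it is
   enough to consider the atoms {S k = A} and {S i = B i, i < k}. *)
Definition indep_of_past (S : nat -> T -> {set 'I_n}) : Prop :=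
  forall k (A : {set 'I_n}) (B : nat -> {set 'I_n}),
    P ([set w | S k w = A] `&` [set w | forall i, (i < k)%N -> S i w = B i])
    = (P [set w | S k w = A]
       * P [set w | forall i, (i < k)%N -> S i w = B i])%E.

End Sampling.

Section Algorithm.
Variables (R : realType) (d n : nat).
Implicit Types (f : 'I_n -> 'cV[R]_d -> R) (psi : 'cV[R]_d -> \bar R).
Implicit Types (p v : 'I_n -> R) (x xs : 'cV[R]_d) (A : {set 'I_n}).

Definition average f x : R := n%:R^-1 * \sum_(j < n) f j x.

(* n * min_j p_j / v_j, where p_j / v_j = +oo if v_j = 0. The minimum is
   finite unless all v_j vanish. *)
Definition stepsize p v : R :=
  n%:R * fine (\big[mine/+oo]_(j < n)
                 (if v j == 0%R then +oo else (p j / v j)%:E))%E.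

Definition star_grad f p xs A x : 'cV[R]_d :=
  n%:R^-1 *: \sum_(j < n) grad (f j) xs
  + \sum_(j in A) (n%:R * p j)^-1 *: (grad (f j) x - grad (f j) xs).

(* k-th iterate when the sampled sets are S 0, S 1, ... *)
Fixpoint sgd_star f psi p (alpha : R) xs (x0 : 'cV[R]_d)
    (S : nat -> {set 'I_n}) (k : nat) : 'cV[R]_d :=
  if k is k'.+1 then
    let x := sgd_star f psi p alpha xs x0 S k' in
    prox alpha psi (x - alpha *: star_grad f p xs (S k') x)
  else x0.

End Algorithm.

(* Main.v *)
Require Import Defs.
From mathcomp Require Import complex ring lra measurable_realfun.

(** The vector [q = grad f_j x - grad f_j xs] lies in the range of [M_j], and
    minimising the quadratic upper model of [f_j] around [x] gives
    [q = M_j^(1/2) h_j] with [|h_j|^2 <= 2 D_j], where [D_j] is the Bregman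
    divergence of [f_j] from [xs] to [x]. The sampling inequality for the vectors
    [h_j / (n p_j)] then bounds the second moment of the stochastic part of the
    step by [2 / alpha] times the mean of the [D_j], since
    [alpha v_j <= n p_j]. Expanding the square, this cancels against the cross
    term up to the quasi strong convexity gap, so that a gradient step contracts
    the mean squared distance to [xs - alpha grad f xs] by [1 - alpha sigma].
    The minimiser [xs] is the proximal point of [xs - alpha grad f xs] and the
    proximal map is nonexpansive, so the same factor holds for the full step;
    by independence [k] steps contract by at most
    [exp (- alpha sigma k)], because [1 - t <= exp (- t)]. *)

Set Implicit Arguments.
Unset Strict Implicit.
Unset Printing Implicit Defensive.

Local Open Scope classical_set_scope.
Local Open Scope ring_scope.

(** * Inner product and positive semidefinite square roots *)

Section Dot.
Variables (R : realType) (d : nat).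
Implicit Types (x y z : 'cV[R]_d) (A : 'M[R]_d).

Lemma dotE x y : dot x y = (x^T *m y) 0 0.
Proof. by rewrite mxE; apply: eq_bigr => i _; rewrite mxE. Qed.

Lemma dotC x y : dot x y = dot y x.
Proof. by apply: eq_bigr => i _; rewrite mulrC. Qed.

Lemma dotDl x y z : dot (x + y) z = dot x z + dot y z.
Proof. by rewrite !dotE linearD mulmxDl mxE. Qed.

Lemma dotZl a x y : dot (a *: x) y = a * dot x y.
Proof. by rewrite !dotE linearZ -scalemxAl mxE. Qed.

Lemma dotDr x y z : dot z (x + y) = dot z x + dot z y.
Proof. by rewrite dotC dotDl !(dotC z). Qed.

Lemma dotZr a x y : dot x (a *: y) = a * dot x y.
Proof. by rewrite dotC dotZl dotC. Qed.

Lemma dotNl x y : dot (- x) y = - dot x y.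
Proof. by rewrite -scaleN1r dotZl mulN1r. Qed.

Lemma dotNr x y : dot x (- y) = - dot x y.
Proof. by rewrite dotC dotNl dotC. Qed.

Lemma dot0l x : dot 0 x = 0.
Proof. by rewrite -(scale0r 0) dotZl mul0r. Qed.

Lemma dot0r x : dot x 0 = 0.
Proof. by rewrite dotC dot0l. Qed.

Lemma dot_suml (I : Type) (r : seq I) (Q : pred I) (F : I -> 'cV[R]_d) y :
  dot (\sum_(i <- r | Q i) F i) y = \sum_(i <- r | Q i) dot (F i) y.
Proof. by elim/big_rec2: _ => [|i ? ? _ <-]; rewrite ?dot0l ?dotDl. Qed.

Lemma dot_mulmxr A x y : dot x (A *m y) = dot (A^T *m x) y.
Proof. by rewrite !dotE trmx_mul trmxK mulmxA. Qed.

Definition dot_lin := (dotDl, dotDr, dotNl, dotNr, dotZl, dotZr, dot0l, dot0r).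

Lemma sqnorm_ge0 x : 0 <= sqnorm x.
Proof. by apply: sumr_ge0 => i _; rewrite -expr2 sqr_ge0. Qed.

Lemma sqnorm_eq0 x : (sqnorm x == 0) = (x == 0).
Proof.
apply/eqP/eqP => [/eqP|->]; last by rewrite /sqnorm dot0l.
rewrite psumr_eq0; last by move=> i _; rewrite -expr2 sqr_ge0.
move=> /allP x0; apply/matrixP => i j; rewrite ord1 mxE.
by apply/eqP; have := x0 i (mem_index_enum _); rewrite -expr2 sqrf_eq0.
Qed.

Lemma sqnormD x y : sqnorm (x + y) = sqnorm x + 2 * dot x y + sqnorm y.
Proof. by rewrite /sqnorm !dot_lin (dotC y x); ring. Qed.

Lemma sqnormZ a x : sqnorm (a *: x) = a ^+ 2 * sqnorm x.
Proof. by rewrite /sqnorm !dot_lin; ring. Qed.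

End Dot.

(** Take a complex root with real part [a] and imaginary part [b]. If [b] is nonzero, the remainder
    modulo the real quadratic [Q] has degree at most one and vanishes at a nonreal point, so it is
    zero. *)
Lemma poly_root_or_quadratic (R : rcfType) (p : {poly R}) : (1 < size p)%N ->
  (exists a, root p a) \/
  exists a b, b != 0 /\ (('X - a%:P) ^+ 2 + (b ^+ 2)%:P) %| p.
Proof.
move=> p1; pose toC := map_poly (real_complex R).
have : size (toC p) != 1%N by rewrite size_map_poly; case: size p1 => [|[|]].
move=> /closed_rootP[[a b] rz]; have [b0|b0] := eqVneq b 0.
  left; exists a; move: rz; rewrite b0 -[(a +i* 0)%C]/(real_complex R a).
  by rewrite fmorph_root.
right; exists a, b; split => //; set Q := _ + _.
have mQ : Q = 'X^2 + (- (2 * a)) *: 'X + (a ^+ 2 + b ^+ 2)%:P.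
  rewrite /Q polyCD rmorphXn/= -mul_polyC rmorphN rmorphM/= [2%:P](rmorph_nat polyC 2).
  by ring.
have sQ : size Q = 3%N.
  rewrite mQ -addrA size_polyDl ?size_polyXn//.
  apply: (leq_ltn_trans (size_polyD _ _)); rewrite gtn_max ltnS.
  rewrite (leq_trans (size_scale_leq _ _)) ?size_polyX//=.
  by rewrite (leq_ltn_trans (size_polyC_leq1 _)).
have QN0 : Q != 0 by rewrite -size_poly_eq0 sQ.
have Qz : root (toC Q) (a +i* b)%C.
  rewrite rootE mQ /toC !rmorphD/= linearZ/= !(map_polyXn, map_polyX, map_polyC).
  rewrite hornerE !hornerE /=.
  apply/eqP; rewrite expr2; simpc.
  by apply/eqP; rewrite eq_complex/=; apply/andP; split; apply/eqP; ring.
rewrite /dvdp; apply/eqP; set r := p %% Q.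
have rz0 : root (toC r) (a +i* b)%C.
  rewrite rootE; move: rz Qz; rewrite !rootE {1}(divp_eq p Q) /toC rmorphD rmorphM/=.
  rewrite hornerD hornerM => /eqP pz /eqP Qz0.
  by rewrite Qz0 mulr0 add0r in pz; rewrite pz.
have sr : (size r <= 2)%N by rewrite -ltnS -sQ ltn_modp.
have rE : r = r`_1 *: 'X + (r`_0)%:P.
  apply/polyP => i; rewrite !coefE; case: i => [|[|i]] /=;
    rewrite ?mulr0 ?mulr1 ?add0r ?addr0//.
  by rewrite nth_default// (leq_trans sr).
move: rz0; rewrite rootE rE /toC rmorphD/= linearZ/= map_polyX map_polyC/=.
rewrite !hornerE/=; simpc.
rewrite eq_complex/= => /andP[/eqP h1 /eqP h2].
have r1 : r`_1 = 0 by move/eqP: h2; rewrite mulf_eq0 (negbTE b0) orbF => /eqP.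
by move: h1; rewrite r1 mul0r add0r scale0r => ->; rewrite addr0.
Qed.


Section SquareRoot.
Variables (R : realType) (d : nat) (M : 'M[R]_d.+1).
Hypothesis Mpsd : sympsd M.
Let D := d.+1.
Implicit Types (N : 'M[R]_D) (x y : 'cV[R]_D).

Let col_mul (A N : 'M[R]_D) j : col j (A *m N) = A *m col j N.
Proof. by rewrite !colE mulmxA. Qed.

Lemma mulmx_injP (A N : 'M[R]_D) : (forall x, A *m x = 0 -> x = 0) ->
  A *m N = 0 -> N = 0.
Proof.
move=> injA AN; apply/matrixP => i j.
have : col j N = 0 by apply: injA; rewrite -col_mul AN col0.
by move=> /matrixP /(_ i 0); rewrite !mxE.
Qed.

Let dotM x y : dot x (M *m y) = dot (M *m x) y.
Proof. by rewrite dot_mulmxr; case: Mpsd => ->. Qed.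

Let dotMB a x y :
  dot x ((M - a%:M) *m y) = dot ((M - a%:M) *m x) y.
Proof. by rewrite !mulmxBl !mul_scalar_mx !dot_lin dotM. Qed.

(** A negative eigenvalue would give [dot x (M *m x) = a * sqnorm x], which is nonnegative only for
    [x = 0]. *)
Let kerMB_lt0 a x : a < 0 -> (M - a%:M) *m x = 0 -> x = 0.
Proof.
move=> a0 xE; apply/eqP; rewrite -sqnorm_eq0.
have /(congr1 (dot x)) := xE; rewrite mulmxBl mul_scalar_mx !dot_lin.
move=> /eqP; rewrite subr_eq0 => /eqP e.
have := Mpsd.2 x; rewrite e nmulr_rge0// => h.
by rewrite eq_le h sqnorm_ge0.
Qed.

(** By symmetry, pairing the square with [x] yields [sqnorm ((M - a%:M) *m x)]; there are no
    nontrivial Jordan blocks. *)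
Let kerMB_sqr a x :
  (M - a%:M) *m ((M - a%:M) *m x) = 0 -> (M - a%:M) *m x = 0.
Proof.
move=> xE; apply/eqP; rewrite -sqnorm_eq0 /sqnorm -dotMB xE dot0r.
exact: eqxx.
Qed.

(** Pairing with [x] gives a vanishing sum of two squares: nonreal eigenvalues do not occur. *)
Let kerMB_quad a b x : b != 0 ->
  (M - a%:M) *m ((M - a%:M) *m x) + b ^+ 2 *: x = 0 -> x = 0.
Proof.
move=> b0 /(congr1 (dot x)); rewrite !dot_lin dotMB => e.
apply/eqP; rewrite -sqnorm_eq0; move: e => /eqP.
rewrite paddr_eq0 ?sqnorm_ge0 ?(mulr_ge0 (sqr_ge0 b) (sqnorm_ge0 x))//.
by rewrite mulf_eq0 sqrf_eq0 (negbTE b0) => /andP[].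
Qed.

Let mulmxP a m (N : 'M[R]_(D, m)) : horner_mx M ('X - a%:P) *m N = (M - a%:M) *m N.
Proof. by rewrite rmorphB/= horner_mx_X horner_mx_C. Qed.

(* Factors of an annihilating polynomial that are invertible at [M] or repeated
   can be discarded, because [M] is symmetric positive semidefinite. *)
Lemma annihilating_prod_XsubC n (p : {poly R}) N : (size p <= n)%N -> p != 0 ->
  horner_mx M p *m N = 0 ->
  exists s : seq R, [/\ uniq s, all (>= 0) s &
    horner_mx M (\prod_(a <- s) ('X - a%:P)) *m N = 0].
Proof.
elim: n p N => [|n IH] p N sp p0 pN.
  by rewrite leqn0 size_poly_eq0 (negbTE p0) in sp.
have [/size1_polyC pc|p1] := leqP (size p) 1.
  exists [::]; split => //; rewrite big_nil rmorph1 mul1mx.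
  move: pN; rewrite pc horner_mx_C mul_scalar_mx => /eqP.
  rewrite scaler_eq0 => /orP[/eqP p00|/eqP//].
  by rewrite pc p00 eqxx in p0.
have step q r : p = r * q -> (1 < size r)%N -> (size q <= n)%N /\ q != 0.
  move=> pE r1; have q0 : q != 0 by apply: contraNneq p0 => q0; rewrite pE q0 mulr0.
  have r0 : r != 0 by rewrite -size_poly_gt0; case: size r1.
  split => //; move: sp; rewrite pE size_mul//.
  by case: size r1 => [|[|m]]// _; rewrite addSn/= addSn ltnS;
    apply: leq_trans; rewrite leq_addl.
have [[a /factor_theorem[q pE]]|[a [b [b0 /dvdpP[q pE]]]]] := poly_root_or_quadratic p1.
  rewrite mulrC in pE; have [|sq q0] := step _ _ pE; first by rewrite size_XsubC.
  move: pN; rewrite pE => pN.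
  have [a0|a0] := ltP a 0.
    apply: (IH q) => //; move: pN; rewrite rmorphM/= -mulmxA mulmxP.
    by apply: mulmx_injP => x; exact: kerMB_lt0.
  (* The factor at a root [a >= 0] is absorbed into [N], which is why the induction runs over a
     general [N]. *)
  have [|s [us s0 sN]] := IH q ((M - a%:M) *m N) sq q0.
    by move: pN; rewrite mulrC rmorphM/= -mulmxA mulmxP.
  have sN' : horner_mx M (('X - a%:P) * \prod_(a <- s) ('X - a%:P)) *m N = 0.
    by rewrite mulrC rmorphM/= -mulmxA mulmxP.
  have [as_|as_] := boolP (a \in s); last first.
    by exists (a :: s); rewrite /= as_ us a0 s0 big_cons.
  (* The factor at [a] now occurs twice, and [kerMB_sqr] removes one copy column by column. *)
  exists s; split => //; move: sN'; rewrite (big_rem a)//= !rmorphM/= -!mulmxA !mulmxP.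
  set X := horner_mx _ _ *m N => h; apply/matrixP => i j.
  have : (M - a%:M) *m col j X = 0.
    by apply: kerMB_sqr; rewrite -!col_mul h col0.
  by rewrite -col_mul => /matrixP /(_ i 0); rewrite !mxE.
rewrite mulrC in pE; have [|sq q0] := step _ _ pE.
  rewrite size_polyDl ?size_exp_XsubC// (leq_ltn_trans (size_polyC_leq1 _))//.
apply: (IH q) => //; move: pN; rewrite pE rmorphM/= -mulmxA.
apply: mulmx_injP => x; rewrite rmorphD/= horner_mx_C mulmxDl mul_scalar_mx.
by rewrite expr2 rmorphM/= -mulmxA !mulmxP; exact: kerMB_quad.
Qed.

(** Newton interpolation: the correction for a new node vanishes at the earlier ones. *)
Lemma interpolation_exists (s : seq R) (g : R -> R) : uniq s ->
  exists p : {poly R}, {in s, forall a, p.[a] = g a}.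
Proof.
elim: s => [|a s IH] /=; first by exists 0.
move=> /andP[as_ /IH[p pg]]; set Q := \prod_(b <- s) ('X - b%:P).
have Qa : Q.[a] != 0 by rewrite -/(root Q a) root_prod_XsubC.
exists (p + ((g a - p.[a]) / Q.[a]) *: Q) => b.
rewrite inE hornerD hornerZ => /predU1P[->|bs].
  by rewrite divfK// addrC subrK.
have /rootP -> : root Q b by rewrite root_prod_XsubC.
by rewrite mulr0 addr0 pg.
Qed.

Lemma trmx_horner_mx (p : {poly R}) : (horner_mx M p)^T = horner_mx M p.
Proof.
elim/poly_ind: p => [|p c IH]; first by rewrite rmorph0 trmx0.
rewrite rmorphD rmorphM/= horner_mx_X horner_mx_C linearD/= tr_scalar_mx.
congr (_ + _); rewrite -[_ * _]/(_ *m _) trmx_mul IH Mpsd.1.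
exact/esym/comm_horner_mx.
Qed.

(* [B = s(M)^2], where [s] interpolates the fourth root on the spectrum, so
   that [B] is visibly positive semidefinite. *)
Lemma sympsd_sqrt_exists_pos : exists B : 'M[R]_D, sympsd B /\ B *m B = M.
Proof.
have [|t [ut t0 tM]] := annihilating_prod_XsubC (leqnn _)
   (monic_neq0 (char_poly_monic M)) (_ : _ *m 1%:M = 0).
  by rewrite mulmx1 Cayley_Hamilton.
rewrite mulmx1 in tM.
have [p pE] := interpolation_exists (fun a => Num.sqrt (Num.sqrt a)) ut.
(* [p ^+ 4 - 'X] vanishes at the distinct points of [t], so the annihilating product divides it and
   [p(M)^4 = M]. *)
have /dvdpP[q qE] : \prod_(a <- t) ('X - a%:P) %| p ^+ 4 - 'X.
  apply: uniq_roots_dvdp; last by rewrite uniq_rootsE.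
  apply/allP => a at_; rewrite rootE !hornerE pE//.
  by rewrite (exprM _ 2 2) !sqr_sqrtr ?sqrtr_ge0 ?subrr// (allP t0).
pose C := horner_mx M p; have CT : C^T = C by exact: trmx_horner_mx.
exists (C *m C); split; first split.
- by rewrite trmx_mul CT.
- by move=> x; rewrite -mulmxA dot_mulmxr CT sqnorm_ge0.
- have : horner_mx M (p ^+ 4 - 'X) = 0 by rewrite qE rmorphM/= tM mulr0.
  rewrite rmorphB/= horner_mx_X rmorphXn/= => /eqP; rewrite subr_eq0 => /eqP <-.
  by rewrite (exprM _ 2 2).
Qed.

End SquareRoot.

Lemma sqrtmxP (R : realType) (d : nat) (M : 'M[R]_d) : sympsd M ->
  sympsd (sqrtmx M) /\ sqrtmx M *m sqrtmx M = M.
Proof.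
move=> Mpsd; suff : [set B | sympsd B /\ B *m B = M] !=set0 by case/(@getPex _ _).
case: d M Mpsd => [|d] M Mpsd; last exact: sympsd_sqrt_exists_pos.
by exists M; split => //; apply/matrixP => -[].
Qed.

(** * Smooth convex functions and optimality conditions *)

(** An explicit passage to [t = 0]: if [b < a], the chosen [t] makes [t * c] smaller than the gap
    [a - b]. *)
Lemma ler_small_step (R : realFieldType) (a b c : R) :
  (forall t, 0 < t < 1 -> a <= b + t * c) -> a <= b.
Proof.
move=> h; rewrite leNgt; apply/negP => ba.
pose t := (a - b) / (a - b + `|c| + 1).
have D0 : 0 < a - b + `|c| + 1 by have := normr_ge0 c; lra.
have t01 : 0 < t < 1.
  by rewrite /t divr_gt0 ?ltr_pdivrMr//; have := normr_ge0 c; lra.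
have := h t t01; rewrite leNgt => /negP; apply.
rewrite -ltrBrDl /t mulrAC ltr_pdivrMr// ltr_pM2l; last by lra.
by have := ler_norm c; lra.
Qed.

Section SmoothConvex.
Variables (R : realType) (d : nat).
Implicit Types (f : 'cV[R]_d -> R) (M : 'M[R]_d).

Lemma convex_functionP f (x y : 'cV[R]_d) (t : R) :
  convex_function [set: 'cV[R]_d] f -> 0 <= t <= 1 ->
  f (t *: x + (1 - t) *: y) <= t * f x + (1 - t) * f y.
Proof.
move=> cf /andP[t0 t1].
by have := cf (Itv01 t0 t1) x y (in_setT _) (in_setT _).
Qed.

(* Smoothness at [y - t w] and convexity bound [f (y + t w)] below by
   [f y + t <grad f y, w> - O(t^2)]; convexity then rescales to [t = 1]. *)
Lemma convex_grad_le f M x y : convex_function [set: 'cV[R]_d] f ->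
  matrix_smooth f M -> f y + dot (grad f y) (x - y) <= f x.
Proof.
move=> cf sf; set g := grad f y; set w := x - y.
apply: (@ler_small_step _ _ _ (2^-1 * dot w (M *m w))) => t /andP[t0 t1].
have h1 : f y <= 2^-1 * f (y + t *: w) + (1 - 2^-1) * f (y - t *: w).
  have e : 2^-1 *: (y + t *: w) + (1 - 2^-1) *: (y - t *: w) = y.
    by apply/matrixP => i j; rewrite !mxE; lra.
  rewrite -{1}e; by apply: convex_functionP => //; lra.
have h2 : f (y + t *: w) <= t * f x + (1 - t) * f y.
  have -> : y + t *: w = t *: x + (1 - t) *: y.
    by apply/matrixP => i j; rewrite !mxE; ring.
  by apply: convex_functionP => //; lra.
clearbody w; have := sf (y - t *: w) y.
rewrite -/g [_ - _ - y]addrAC subrr add0r mulmxN -scalemxAr !dot_lin.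
set a := dot g w; set b := dot w _ => h3.
rewrite -(ler_pM2l t0); nra.
Qed.

Definition bregman f x y := f x - f y - dot (grad f y) (x - y).

(* Minimising the quadratic upper model of [bregman f _ y] around [x]. *)
Lemma grad_diff_sqrtmx f M x y : convex_function [set: 'cV[R]_d] f ->
  sympsd M -> matrix_smooth f M ->
  exists h, grad f x - grad f y = sqrtmx M *m h /\
            sqnorm h <= 2 * bregman f x y.
Proof.
move=> cf Mpsd sf; set q := _ - _.
(* Convexity bounds [f (x + w)] below from [y], and smoothness bounds it above from [x]. *)
have low w : 0 <= bregman f x y + dot q w + 2^-1 * dot w (M *m w).
  have := convex_grad_le (x + w) y cf sf.
  have := sf (x + w) x; rewrite [_ + _ - x]addrAC subrr add0r [_ + _ - y]addrAC.
  rewrite /bregman /q !dot_lin; lra.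
(* On the kernel of [M] the model is affine; were [dot q w] nonzero, the chosen multiple of [w]
   would give it the value -1. *)
clearbody q; have qker w : M *m w = 0 -> dot q w = 0.
  move=> Mw; apply/eqP/negPn/negP => qw.
  have := low (- ((bregman f x y + 1) / dot q w) *: w).
  rewrite -scalemxAr Mw !dot_lin mulNr divfK//; lra.
(* Since [M] is symmetric, orthogonality to its kernel means membership in its range. *)
have [u qu] : exists u, q = M *m u.
  have /submxP[D qD] : (q^T <= M)%MS.
    rewrite submxE; apply/eqP/matrixP => i j; rewrite !ord1 [RHS]mxE.
    have : M *m col j (cokermx M) = 0 by rewrite colE mulmxA mulmx_coker mul0mx.
    by move=> /qker; rewrite dotE colE mulmxA -colE mxE.
  by exists D^T; rewrite -[LHS]trmxK qD trmx_mul Mpsd.1.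
have [[BT _] BB] := sqrtmxP Mpsd.
exists (sqrtmx M *m u); split; first by rewrite mulmxA BB.
have uMu : dot u (M *m u) = sqnorm (sqrtmx M *m u).
  by rewrite -[X in X *m u]BB -mulmxA dot_mulmxr BT.
(* [- u] minimises the quadratic model, because [q = M *m u]. *)
by have := low (- u); rewrite mulmxN !dot_lin qu (dotC (M *m u)) uMu; lra.
Qed.

Lemma grad_average n (f : 'I_n -> 'cV[R]_d -> R) x :
  (forall j y, differentiable (f j) y) ->
  grad (average f) x = n%:R^-1 *: \sum_(j < n) grad (f j) x.
Proof.
move=> df; apply/matrixP => i k; rewrite !mxE summxE.
have -> : average f = n%:R^-1 \*: (\sum_(j < n) f j).
  by apply/funext => y; rewrite /average /= fct_sumE.
rewrite deriveZ; last first.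
  by apply: derivable_sum => j; apply: diff_derivable.
rewrite derive_sum; last by move=> j; apply: diff_derivable.
by congr (_ * _); apply: eq_bigr => j _; rewrite mxE.
Qed.

End SmoothConvex.

Section Optimality.
Variables (R : realType) (d : nat).
Implicit Types (psi : 'cV[R]_d -> \bar R) (u y : 'cV[R]_d).

(** Compare [u] with nearby points of the segment towards [y], divide by [t] and let [t] tend to 0.
    Here [a] stands for the directional derivative of [g]; both the proximal point and [xs] are
    treated this way. *)
Lemma argmin_optimality psi (g : 'cV[R]_d -> R) (alpha a c r s : R) u y :
  econvex psi -> 0 < alpha ->
  argmin (fun x => alpha%:E * psi x + (g x)%:E)%E u ->
  psi u = s%:E -> psi y = r%:E ->
  (forall t, 0 < t < 1 -> g (t *: y + (1 - t) *: u) <= g u + t * a + t ^+ 2 * c) ->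
  alpha * s <= alpha * r + a.
Proof.
move=> cpsi alpha0 umin us yr gle; apply: (@ler_small_step _ _ _ c) => t t01.
have := umin (t *: y + (1 - t) *: u).
have := cpsi y u t t01; rewrite us yr -!EFinM -EFinD.
case: (psi (t *: y + _)) => [z| |]; last 2 first.
- by rewrite leye_eq.
- by rewrite gt0_muleNy ?lte_fin// addNye -EFinM -EFinD.
rewrite -!EFinM -!EFinD !lee_fin => h1 h2.
have h3 := gle t t01; move/andP: t01 => [t0 t1].
have h4 : alpha * z <= alpha * (t * r + (1 - t) * s) by rewrite ler_pM2l.
rewrite -(ler_pM2l t0); nra.
Qed.

Lemma argmin_fin psi (g : 'cV[R]_d -> R) (alpha : R) u :
  proper_function psi -> 0 < alpha ->
  argmin (fun x => alpha%:E * psi x + (g x)%:E)%E u ->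
  exists s, psi u = s%:E.
Proof.
move=> [psiN [y psiy]] alpha0 /(_ y).
case: (psi u) (psiN u) => [s|//|//]; first by exists s.
move=> _; rewrite gt0_muley ?lte_fin// addye// leye_eq.
by case: (psi y) (psiN y) psiy => [z|//|//]; rewrite -EFinM -EFinD.
Qed.

End Optimality.

(** * The proximal map *)

Section Prox.
Variables (R : realType) (d : nat).
Implicit Types (psi : 'cV[R]_d -> \bar R) (u x y z : 'cV[R]_d).

Lemma trmx_continuous m n : continuous (fun A : 'M[R]_(m, n) => A^T).
Proof.
move=> A U /nbhs_ballP[e e0 eU]; apply/nbhs_ballP; exists e => // B [_ AB].
by apply: eU; split=> // i j; rewrite !mxE; exact: AB.
Qed.

Lemma box_compact z (r : R) :
  compact [set u : 'cV[R]_d | forall i, u i 0 \in `[z i 0 - r, z i 0 + r]].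
Proof.
have -> : [set u : 'cV[R]_d | forall i, u i 0 \in `[z i 0 - r, z i 0 + r]] =
  (fun v : 'rV[R]_d => v^T) @`
    [set v : 'rV[R]_d | forall i, `[z i 0 - r, z i 0 + r]%classic (v ord0 i)].
  apply/seteqP; split => [u uB|_ [v vB <-] i]; last by rewrite mxE; exact: vB.
  by exists u^T; rewrite ?trmxK// => i; rewrite mxE; exact: uB.
apply: continuous_compact; first by apply: continuous_subspaceT; exact: trmx_continuous.
apply: (@rV_compact _ _ (fun i => `[z i 0 - r, z i 0 + r]%classic)) => i.
exact: segment_compact.
Qed.

Lemma prox_objective_continuous (alpha : R) z :
  continuous (fun w : 'cV[R]_d * R => alpha * w.2 + 2^-1 * sqnorm (w.1 - z)).
Proof.
move=> w; apply: cvgD; first by apply: cvgM; [exact: cvg_cst|exact: cvg_snd].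
apply: cvgM; first exact: cvg_cst.
apply: cvg_big => [|i _]; first exact: add_continuous.
have c : (v.1 - z) i 0 @[v --> w] --> (w.1 - z) i 0.
  have -> : (fun v : 'cV[R]_d * R => (v.1 - z) i 0) = (fun v => v.1 i 0 - z i 0).
    by apply/funext => v; rewrite !mxE.
  rewrite !mxE; apply: cvgB; last exact: cvg_cst.
  apply: (@cvg_comp _ _ _ fst (fun u : 'cV[R]_d => u i 0)); first exact: cvg_fst.
  exact: coord_continuous.
exact: cvgM.
Qed.

(* The affine minorant makes the objective coercive, so it can be minimised over
   a compact part of the epigraph of [psi]. *)
Lemma prox_exists psi (alpha s : R) g x z :
  proper_function psi -> closed_function psi -> 0 < alpha ->
  (forall y r, psi y = r%:E -> s + dot g (y - x) <= r) ->
  argmin (fun u => alpha%:E * psi u + (2^-1 * sqnorm (u - z))%:E)%E !=set0.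
Proof.
move=> [psiN [y0 psiy0]] psicl alpha0 minor.
have [r0 y0r] : exists r, psi y0 = r%:E.
  by case: (psi y0) (psiN y0) psiy0 => // r; exists r.
pose G (w : 'cV[R]_d * R) := alpha * w.2 + 2^-1 * sqnorm (w.1 - z).
pose c := G (y0, r0).
pose C := [set w : 'cV[R]_d * R | (psi w.1 <= w.2%:E)%E].
(* [e] is the affine minorant at [z]. The sublevel set [G w <= c] satisfies
   [sqnorm (u - z) <= 4 * K], and a real whose square is at most [4 * K] has absolute value at most
   [r]. *)
pose e := s + dot g (z - x).
pose K := c - alpha * e + sqnorm (alpha *: g).
pose r := 4 * K + 1.
pose lo := e - sqnorm g - K.
have bound w : C w -> G w <= c ->
    (forall i, w.1 i 0 \in `[z i 0 - r, z i 0 + r]) /\ w.2 \in `[lo, c / alpha].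
  case: w => u t; rewrite /C /G /= => ut Gc.
  have tge : e + dot g (u - z) <= t.
    have -> : e + dot g (u - z) = s + dot g (u - x).
      by rewrite /e !dot_lin; ring.
    case psiu : (psi u) ut => [q| |]; rewrite ?leye_eq// ?lee_fin.
      exact/le_trans/minor.
    by have := psiN u; rewrite psiu.
  (* Young's inequality with weight 1/4, which leaves half of the quadratic term of [G] for
     coercivity. *)
  have sq h : 0 <= sqnorm h + dot h (u - z) + 4^-1 * sqnorm (u - z).
    by have := sqnorm_ge0 (h + 2^-1 *: (u - z)); rewrite sqnormD sqnormZ dotZr; lra.
  have wK : 4^-1 * sqnorm (u - z) <= K.
    have := sq (alpha *: g); rewrite dotZl => h.
    have := tge; rewrite -(ler_pM2l alpha0) mulrDr => h'.
    by rewrite /K; lra.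
  have n0 := sqnorm_ge0 (u - z); split.
    move=> i; have : (u i 0 - z i 0) ^+ 2 <= sqnorm (u - z).
      rewrite /sqnorm /dot (bigD1 i)//= !mxE -expr2 lerDl.
      by apply: sumr_ge0 => j _; rewrite -expr2 sqr_ge0.
    by rewrite in_itv/= /r => h; apply/andP; split; nra.
  rewrite in_itv/= ler_pdivlMr// mulrC; apply/andP; split; last by lra.
  by have := sq g; rewrite /lo; lra.
pose B := C `&` ([set u : 'cV[R]_d | forall i, u i 0 \in `[z i 0 - r, z i 0 + r]]
           `*` `[lo, c / alpha]%classic).
have cB : compact B.
  rewrite /B setIC; apply: compact_closedI; last exact: psicl.
  by apply: compact_setX; [exact: box_compact|exact: segment_compact].
have B0 : B (y0, r0).
  have C0 : C (y0, r0) by rewrite /C /= y0r.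
  by split => //; have [? ?] := bound _ C0 (lexx _).
have [] := @compact_EVT_min _ R G B _ cB _; first by exists (y0, r0).
  by apply: continuous_subspaceT; exact: prox_objective_continuous.
move=> [u t] /set_mem[utC _] umin.
exists u => y; apply: (@le_trans _ _ (G (u, t))%:E).
  by rewrite /G/= EFinD !EFinM leeD2r// lee_pmul2l// lte_fin.
case psiy : (psi y) => [q| |].
- rewrite -EFinM -EFinD lee_fin -/(G (y, q)).
  (* Points whose value exceeds [c] are beaten by [(y0, r0)], which lies in [B]. *)
  have [qc|/ltW qc] := leP (G (y, q)) c.
    have Cq : C (y, q) by rewrite /C/= psiy.
    by apply: umin; apply/mem_set; split => //; have [? ?] := bound _ Cq qc.
  by apply: le_trans qc; apply: umin; exact/mem_set.
- by rewrite gt0_muley ?lte_fin// addye// leey.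
- by have := psiN y; rewrite psiy.
Qed.

(** The last hypothesis makes [- g] a subgradient at [x], so [x] is the proximal point of
    [x - alpha *: g]. Adding this inequality to the one at [prox alpha psi z] is monotonicity of the
    subdifferential, which implies nonexpansiveness. *)
Lemma prox_dist_le psi (alpha s : R) g x z :
  proper_function psi -> closed_function psi -> econvex psi -> 0 < alpha ->
  psi x = s%:E -> (forall y r, psi y = r%:E -> s - dot g (y - x) <= r) ->
  sqnorm (prox alpha psi z - x) <= sqnorm (z - (x - alpha *: g)).
Proof.
move=> psiP psicl psicv alpha0 xs minor.
have [|] := @prox_exists psi alpha s (- g) x z psiP psicl alpha0.
  by move=> y r yr; rewrite dotNl; exact: minor.
move=> u0 umin0; have umin : argmin
    (fun u => alpha%:E * psi u + (2^-1 * sqnorm (u - z))%:E)%E (prox alpha psi z).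
  by apply: getPex; exists u0.
set u := prox _ _ _ in umin *.
have [q uq] := argmin_fin psiP alpha0 umin.
have := minor _ _ uq; rewrite -(ler_pM2l alpha0) => h1.
have := argmin_optimality (a := dot (u - z) (x - u))
  (c := 2^-1 * sqnorm (x - u)) psicv alpha0 umin uq xs.
move=> /(_ _)/wrap[t t01|h2].
  have -> : t *: x + (1 - t) *: u - z = (u - z) + t *: (x - u).
    by apply/matrixP => i j; rewrite !mxE; ring.
  by rewrite sqnormD sqnormZ dotZr; lra.
have := sqnorm_ge0 (z - (x - alpha *: g) - (u - x)).
clearbody u; move: h1 h2; rewrite /sqnorm !dot_lin.
rewrite (dotC x u) (dotC x z) (dotC x g) (dotC u z) (dotC u g) (dotC z g).
nra.
Qed.

End Prox.

(** * Contraction of one step in expectation *)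

Section OneStep.
Variables (R : realType) (d n : nat) (f : 'I_n -> 'cV[R]_d -> R).
Variables (M : 'I_n -> 'M[R]_d) (psi : 'cV[R]_d -> \bar R) (xs : 'cV[R]_d).
Variables (sigma alpha : R) (p v : 'I_n -> R) (pi : {set 'I_n} -> R).
Hypothesis n_gt0 : (0 < n)%N.
Hypothesis f_diff : forall j x, differentiable (f j) x.
Hypothesis f_convex : forall j, convex_function [set: 'cV[R]_d] (f j).
Hypothesis M_sympsd : forall j, sympsd (M j).
Hypothesis f_smooth : forall j, matrix_smooth (f j) (M j).
Hypothesis f_qsc : quasi_strongly_convex (average f) xs sigma.
Hypothesis p_gt0 : forall j, 0 < p j.
Hypothesis pi_ge0 : forall A, 0 <= pi A.
Hypothesis pi_sum1 : \sum_A pi A = 1.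
Hypothesis piE : forall j, p j = \sum_(A : {set 'I_n} | j \in A) pi A.
Hypothesis eso : forall h : 'I_n -> 'cV[R]_d,
  \sum_A pi A * sqnorm (\sum_(j in A) sqrtmx (M j) *m h j)
  <= \sum_(j < n) p j * v j * sqnorm (h j).
Hypothesis alpha_gt0 : 0 < alpha.
Hypothesis alpha_le : forall j, alpha * v j <= n%:R * p j.

Let ga := grad (average f).

Lemma gradient_step_contraction x :
  \sum_A pi A * sqnorm (x - alpha *: star_grad f p xs A x - (xs - alpha *: ga xs))
  <= (1 - alpha * sigma) * sqnorm (x - xs).
Proof.
pose D j := grad (f j) x - grad (f j) xs.
have np_gt0 j : 0 < n%:R * p j by rewrite mulr_gt0 ?ltr0n.
have n0 : n%:R != 0 :> R by rewrite pnatr_eq0 -lt0n.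
have hP j : exists h, D j = sqrtmx (M j) *m h /\ sqnorm h <= 2 * bregman (f j) x xs.
  exact: grad_diff_sqrtmx.
have [h hE] := choice hP.
pose G (A : {set 'I_n}) := \sum_(j in A) (n%:R * p j)^-1 *: D j.
have GE A : G A = \sum_(j in A) sqrtmx (M j) *m ((n%:R * p j)^-1 *: h j).
  by apply: eq_bigr => j _; rewrite -scalemxAr (hE j).1.
have gaE y : ga y = n%:R^-1 *: \sum_(j < n) grad (f j) y by exact: grad_average.
(* Unbiasedness: after exchanging the sums, the weights of the sets containing [j] add up to [p j],
   cancelling the [p j] in the denominator. *)
have mean : \sum_A pi A * dot (G A) (x - xs) = dot (ga x - ga xs) (x - xs).
  rewrite !gaE -scalerBr -sumrB dotZl dot_suml mulr_sumr.
  transitivity (\sum_(A : {set 'I_n}) \sum_(j < n | j \in A)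
      pi A * ((n%:R * p j)^-1 * dot (D j) (x - xs))).
    by apply: eq_bigr => A _; rewrite dot_suml mulr_sumr;
      apply: eq_bigr => j _; rewrite dotZl.
  rewrite (exchange_big_dep xpredT)//=; apply: eq_bigr => j _.
  rewrite -mulr_suml -piE mulrA; congr (_ * _).
  by rewrite invfM mulrCA divff ?mulr1// gt_eqF.
have second : alpha * \sum_A pi A * sqnorm (G A) <=
    2 * (average f x - average f xs - dot (ga xs) (x - xs)).
  under eq_bigr do rewrite GE.
  apply: (@le_trans _ _ (alpha * \sum_(j < n)
      p j * v j * sqnorm ((n%:R * p j)^-1 *: h j))).
    by rewrite ler_pM2l.
  rewrite gaE dotZl dot_suml /average -!mulrBr -!sumrB mulrCA !mulr_sumr.
  apply: ler_sum => j _; rewrite sqnormZ.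
  apply: (@le_trans _ _ (n%:R^-1 * sqnorm (h j))); last first.
    by rewrite ler_pM2l ?invr_gt0 ?ltr0n//; have := (hE j).2.
  rewrite !mulrA ler_wpM2r ?sqnorm_ge0//.
  have -> : alpha * p j * v j / (n%:R * p j) / (n%:R * p j) =
           n%:R^-1 * ((alpha * v j) / (n%:R * p j)).
    by have pj := lt0r_neq0 (p_gt0 j); field; rewrite pj n0.
  by rewrite ler_piMr ?invr_ge0// ler_pdivrMr// mul1r.
(* The known mean gradient at [xs] cancels against the shift, leaving only the random part [G A]. *)
have expand A : sqnorm (x - alpha *: star_grad f p xs A x - (xs - alpha *: ga xs)) =
    sqnorm (x - xs) - 2 * alpha * dot (G A) (x - xs) + alpha ^+ 2 * sqnorm (G A).
  have -> : x - alpha *: star_grad f p xs A x - (xs - alpha *: ga xs) =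
            (x - xs) + (- alpha) *: G A.
    rewrite /star_grad -gaE -/(G A); apply/matrixP => i j; rewrite !mxE; ring.
  by rewrite sqnormD sqnormZ dotZr dotC; ring.
under eq_bigr do rewrite expand mulrDr mulrBr.
rewrite big_split/= sumrB -mulr_suml pi_sum1 mul1r.
under [X in _ - X]eq_bigr do rewrite mulrCA.
under [X in _ + X]eq_bigr do rewrite mulrCA.
(* The terms in [ga xs] from [mean] and [second] cancel; what is left is [2 * alpha] times the quasi
   strong convexity gap. *)
rewrite -!mulr_sumr mean; have := f_qsc x.
move: second; rewrite -/ga -[xs - x]opprB dotNr dotDl dotNl.
move: (\sum_A _) => Q second q; rewrite -(ler_pM2l alpha_gt0) in second.
rewrite -(ler_pM2l alpha_gt0) in q; lra.
Qed.

Hypothesis psi_proper : proper_function psi.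
Hypothesis psi_closed : closed_function psi.
Hypothesis psi_convex : econvex psi.
Hypothesis xs_min : argmin (fun x => (average f x)%:E + psi x)%E xs.

Lemma prox_step_contraction x :
  \sum_A pi A * sqnorm (prox alpha psi (x - alpha *: star_grad f p xs A x) - xs)
  <= (1 - alpha * sigma) * sqnorm (x - xs).
Proof.
have xs_min1 : argmin (fun x => 1%:E * psi x + (average f x)%:E)%E xs.
  by move=> y; rewrite !mul1e addeC [leRHS]addeC; exact: xs_min.
have [s xsE] := argmin_fin psi_proper ltr01 xs_min1.
apply: le_trans (gradient_step_contraction x); apply: ler_sum => A _.
apply: ler_wpM2l => //.
apply: (prox_dist_le _ psi_proper psi_closed psi_convex alpha_gt0 xsE).
move=> y r yr; rewrite lerBlDr -[s]mul1r -[r]mul1r.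
pose w := y - xs.
(* Optimality of [xs] makes [- ga xs] a subgradient of [psi] there; the averaged smoothness bounds
   supply the remainder [t ^+ 2 * c]. *)
apply: (argmin_optimality
  (c := n%:R^-1 * \sum_(j < n) 2^-1 * dot w (M j *m w))
  psi_convex ltr01 xs_min1 xsE yr).
move=> t t01; rewrite /ga grad_average// dotZl dot_suml /average.
rewrite mulrCA [t ^+ 2 * _]mulrCA.
rewrite -!mulrDr ler_pM2l ?invr_gt0 ?ltr0n// !mulr_sumr -!big_split/=.
apply: ler_sum => j _.
have := f_smooth j (t *: y + (1 - t) *: xs) xs.
have -> : t *: y + (1 - t) *: xs - xs = t *: w.
  by apply/matrixP => i k; rewrite !mxE; ring.
by rewrite -scalemxAr !dotZr dotZl -/w; lra.
Qed.

End OneStep.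

(** * Expectations over finitely valued random elements and histories *)

Section FiniteExpectation.
Variables (dT : measure_display) (T : measurableType dT) (R : realType).
Variables (P : probability T R).

Lemma expectation_finType (I : finType) (X : T -> I) (F : I -> R) :
  (forall i, measurable [set w | X w = i]) -> (forall i, 0 <= F i) ->
  'E_P[fun w => F (X w)]%E = (\sum_i fine (P [set w | X w = i]) * F i)%:E.
Proof.
move=> mX F0; rewrite unlock.
have FE w : (F (X w))%:E = (\sum_i (F i)%:E * (\1_[set w | X w = i] w)%:E)%E.
  rewrite (bigD1 (X w))//= big1 ?adde0 => [|i iX]; rewrite indicE.
    by rewrite mem_set// mule1.
  by rewrite memNset ?mule0// => /= e; rewrite e eqxx in iX.
under eq_integral do rewrite FE.
have mind i : measurable_fun [set: T] (EFin \o (\1_[set w | X w = i] : T -> R)).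
  by apply/measurable_EFinP; exact: measurable_indic.
rewrite ge0_integral_sum//; last 2 first.
- by move=> i; exact: (measurable_funeM _ (mind i)).
- by move=> i w _; rewrite mule_ge0// lee_fin.
rewrite -sumEFin; apply: eq_bigr => i _.
rewrite ge0_integralZl_EFin//; last exact: mind.
rewrite integral_indic// setIT mulrC EFinM fineK//.
by rewrite fin_num_measure.
Qed.

Lemma measure_finType (I : finType) (X : T -> I) (Q : pred I) :
  (forall i, measurable [set w | X w = i]) ->
  P [set w | Q (X w)] = (\sum_(i | Q i) fine (P [set w | X w = i]))%:E.
Proof.
move=> mX; have mQ : measurable [set w | Q (X w)].
  have -> : [set w | Q (X w)] = \bigcup_(i in [set` Q]) [set w | X w = i].
    by apply/seteqP; split => [w Qw|w [i Qi Xi]]; [exists (X w)|rewrite /= Xi].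
  exact: fin_bigcup_measurable.
rewrite -expectation_indic// big_mkcond/=.
have -> : \1_[set w | Q (X w)] = (fun w => (Q (X w))%:R) :> (T -> R).
  apply/funext => w; rewrite indicE; have [QX|/negP QX] := boolP (Q (X w)).
    by rewrite mem_set.
  by rewrite memNset.
rewrite (expectation_finType (F := fun i => (Q i)%:R))//; congr (_%:E).
by apply: eq_bigr => i _; case: (Q i); rewrite ?mulr1 ?mulr0.
Qed.

End FiniteExpectation.

Lemma sgd_star_prefix (R : realType) (d n : nat) (f : 'I_n -> 'cV[R]_d -> R)
  psi p alpha xs x0 (S S' : nat -> {set 'I_n}) k :
  (forall i, (i < k)%N -> S i = S' i) ->
  sgd_star f psi p alpha xs x0 S k = sgd_star f psi p alpha xs x0 S' k.
Proof.
elim: k => [//|k IH] SS' /=.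
have -> : sgd_star f psi p alpha xs x0 S k = sgd_star f psi p alpha xs x0 S' k.
  by apply: IH => i ik; apply: SS'; rewrite ltnW.
by rewrite (SS' k (ltnSn k)).
Qed.

Section History.
Variables (dT : measure_display) (T : measurableType dT) (R : realType).
Variables (P : probability T R) (n : nat) (Sk : nat -> T -> {set 'I_n}).
Hypothesis Sk_random : forall k, random_set (Sk k).
Hypothesis Sk_indep : indep_of_past P Sk.

Definition history k w : {ffun 'I_k -> {set 'I_n}} := [ffun i : 'I_k => Sk i w].

(** Padding with the empty set turns a history into a sequence that [sgd_star] accepts; the [k]-th
    iterate reads only indices below [k]. *)
Definition extend k (b : {ffun 'I_k -> {set 'I_n}}) (i : nat) : {set 'I_n} :=
  oapp b finset.set0 (insub i).

Lemma extend_history k w i : (i < k)%N -> extend (history k w) i = Sk i w.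
Proof. by move=> ik; rewrite /extend insubT/= ffunE. Qed.

Lemma history_eqE k b :
  [set w | history k w = b] =
  [set w | forall i, (i < k)%N -> Sk i w = extend b i].
Proof.
apply/seteqP; split => w /= => [<- i ik|h]; first by rewrite extend_history.
by apply/ffunP => i; rewrite ffunE h// /extend valK.
Qed.

Lemma measurable_history k b : measurable [set w | history k w = b].
Proof.
rewrite history_eqE.
have -> : [set w | forall i, (i < k)%N -> Sk i w = extend b i] =
    \bigcap_(i in [set i | (i < k)%N]) [set w | Sk i w = extend b i] by [].
by apply: bigcap_measurableType => i _; exact: Sk_random.
Qed.

Lemma history_next_eqE k b A :
  [set w | (history k w, Sk k w) = (b, A)] =
  [set w | Sk k w = A] `&` [set w | history k w = b].
Proof. by apply/seteqP; split => w /= => [[-> ->]|[-> ->]]. Qed.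

(** Finite form of conditioning on the past: independence factorises the joint law of the history
    and the next set. *)
Lemma expectation_history_next k (F : {ffun 'I_k -> {set 'I_n}} * {set 'I_n} -> R) :
  (forall c, 0 <= F c) ->
  'E_P[fun w => F (history k w, Sk k w)]%E =
  (\sum_b fine (P [set w | history k w = b]) *
    \sum_A fine (P [set w | Sk k w = A]) * F (b, A))%:E.
Proof.
move=> F0; rewrite (expectation_finType _ _ F0); last first.
  by move=> [b A]; rewrite history_next_eqE; apply: measurableI;
    [exact: Sk_random|exact: measurable_history].
transitivity (\sum_b \sum_A
    fine (P [set w | (history k w, Sk k w) = (b, A)]) * F (b, A))%:E.
  by rewrite pair_bigA; congr (_%:E); apply: eq_bigr => -[].
congr (_%:E); apply: eq_bigr => b _; rewrite mulr_sumr; apply: eq_bigr => A _.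
rewrite history_next_eqE history_eqE Sk_indep -history_eqE fineM; last 2 first.
- by rewrite fin_num_measure//; exact: Sk_random.
- by rewrite fin_num_measure//; exact: measurable_history.
by rewrite mulrCA mulrA.
Qed.

End History.

(** Indices with [v j = 0] contribute [+oo], so the minimum is attained where [v] is nonzero. Its
    minimality is restated without division, so that it covers [v j = 0] as well. *)
Lemma stepsizeP (R : realType) (n : nat) (p v : 'I_n -> R) :
  (0 < n)%N -> (forall j, 0 < p j) -> (forall j, 0 <= v j) -> (exists j, v j != 0) ->
  exists j0, [/\ 0 < v j0, stepsize p v = n%:R * (p j0 / v j0) &
    forall j, stepsize p v * v j <= n%:R * p j].
Proof.
move=> n0 p0 v0 [i vi]; pose m := [arg min_(j < i | v j != 0) (p j / v j)]%O.
have [vm mmin] : v m != 0 /\ forall j, v j != 0 -> p m / v m <= p j / v j.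
  by rewrite /m; case: arg_minP.
have vm0 : 0 < v m by rewrite lt_neqAle eq_sym vm v0.
have E : stepsize p v = n%:R * (p m / v m).
  rewrite /stepsize; congr (_ * _).
  rewrite (_ : \big[_/_]_(_ < _) _ = (p m / v m)%:E)%E//.
  apply/eqP; rewrite eq_le; apply/andP; split.
    by apply: (@bigmin_inf _ _ _ _ m) => //; rewrite (negbTE vm).
  apply/bigmin_geP; split; first by rewrite leey.
  by move=> j _; case: eqP => [_|/eqP vj]; rewrite ?leey// lee_fin mmin.
exists m; split => // j; rewrite E; have [->|vj] := eqVneq (v j) 0.
  by rewrite mulr0 mulr_ge0// ltW.
rewrite -mulrA ler_pM2l ?ltr0n// -ler_pdivlMr ?mmin//.
by rewrite lt_neqAle eq_sym vj v0.
Qed.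

(** * Iteration complexity *)

Theorem corollaryI1 (R : realType) (d n : nat) (hn : (0 < n)%N)
  (f : 'I_n -> 'cV[R]_d -> R) (M : 'I_n -> 'M[R]_d)
  (psi : 'cV[R]_d -> \bar R) (xs : 'cV[R]_d) (sigma : R)
  (f_diff : forall j x, differentiable (f j) x)
  (f_convex : forall j, convex_function [set: 'cV[R]_d] (f j))
  (M_sympsd : forall j, sympsd (M j))
  (f_smooth : forall j, matrix_smooth (f j) (M j))
  (psi_proper : proper_function psi)
  (psi_closed : closed_function psi)
  (psi_convex : econvex psi)
  (xs_min : argmin (fun x => (average f x)%:E + psi x)%E = [set xs])
  (sigma_gt0 : 0 < sigma)
  (f_qsc : quasi_strongly_convex (average f) xs sigma)
  (dT : measure_display) (T : measurableType dT) (P : probability T R)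
  (S : T -> {set 'I_n}) (S_random : random_set S)
  (p v : 'I_n -> R)
  (pE : forall j, (p j)%:E = P [set w | j \in S w])
  (p_gt0 : forall j, 0 < p j)
  (v_eso : forall h : 'I_n -> 'cV[R]_d,
    ('E_P[fun w => sqnorm (\sum_(j in S w) sqrtmx (M j) *m h j)%R]
     <= (\sum_(j < n) p j * v j * sqnorm (h j))%R%:E)%E)
  (Sk : nat -> T -> {set 'I_n})
  (Sk_random : forall k, random_set (Sk k))
  (Sk_copy : forall k, same_law P (Sk k) S)
  (Sk_indep : indep_of_past P Sk)
  (alpha : R) (alphaE : alpha = stepsize p v)
  (x0 : 'cV[R]_d) (eps : R) (eps01 : 0 < eps < 1) (k : nat)
  (hk : \big[Num.max/0]_(j < n) (v j / (n%:R * p j * sigma)) * ln (1 / eps)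
        <= k%:R) :
  ('E_P[fun w => sqnorm (sgd_star f psi p alpha xs x0 (Sk^~ w) k - xs)%R]
   <= (eps * sqnorm (x0 - xs))%R%:E)%E.
Proof.
(* In dimension 0 both sides vanish; a positive dimension provides the nonzero test vector [u]. *)
case: (posnP d) => [d0|d_gt0].
  have sq0 (x : 'cV[R]_d) : sqnorm x = 0.
    rewrite /sqnorm /dot big1// => i _; have := leq_ltn_trans (leq0n i) (ltn_ord i).
    by rewrite [X in (_ < X)%N]d0.
  by rewrite sq0 mulr0 unlock; under eq_integral do rewrite sq0; rewrite integral0.
pose pi A := fine (P [set w | S w = A]).
have pi_ge0 A : 0 <= pi A by exact: fine_ge0.
have piE j : p j = \sum_(A : {set 'I_n} | j \in A) pi A.
  apply: EFin_inj; rewrite pE.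
  exact: (measure_finType P (fun A : {set 'I_n} => j \in A) S_random).
have pi_sum1 : \sum_A pi A = 1.
  apply: EFin_inj; rewrite -(measure_finType P xpredT S_random).
  by rewrite -(@probability_setT _ _ _ P); congr (P _); apply/seteqP; split.
have eso h : \sum_A pi A * sqnorm (\sum_(j in A) sqrtmx (M j) *m h j)
    <= \sum_(j < n) p j * v j * sqnorm (h j).
  rewrite -lee_fin -(expectation_finType P
    (F := fun A : {set 'I_n} => sqnorm (\sum_(j in A) sqrtmx (M j) *m h j)) S_random).
    exact: v_eso.
  by move=> A; exact: sqnorm_ge0.
pose u : 'cV[R]_d := delta_mx (Ordinal d_gt0) 0.
have u_gt0 : 0 < sqnorm u.
  rewrite lt_neqAle sqnorm_ge0 andbT eq_sym sqnorm_eq0.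
  apply/eqP => /matrixP /(_ (Ordinal d_gt0) 0).
  by rewrite !mxE !eqxx => /eqP; rewrite oner_eq0.
(* Test the sampling inequality on the family equal to [u] at [j] and 0 elsewhere. *)
have v_ge0 j : 0 <= v j.
  have := eso (fun i => if i == j then u else 0).
  rewrite [leRHS](bigD1 j)//= eqxx [X in _ + X]big1 ?addr0; last first.
    by move=> i /negbTE ->; rewrite /sqnorm dot0l mulr0.
  move=> le; have : 0 <= p j * v j * sqnorm u.
    by apply: le_trans le; apply: sumr_ge0 => A _; rewrite mulr_ge0// sqnorm_ge0.
  by rewrite pmulr_lge0// pmulr_rge0.
(* If [v = 0], every step size is admissible, and [2 / sigma] would give the
   contraction factor [-1]. *)
have v_neq0 : exists j, v j != 0.
  apply/not_existsP => v0.
  have v00 j : 2 / sigma * v j <= n%:R * p j.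
    have -> : v j = 0 by apply/eqP/negPn/negP; exact: v0.
    by rewrite mulr0 mulr_ge0// ltW.
  have a0 : 0 < 2 / sigma by rewrite divr_gt0.
  have := gradient_step_contraction hn f_diff f_convex M_sympsd f_smooth f_qsc p_gt0
    pi_sum1 piE eso a0 v00 (xs + u).
  rewrite addrAC subrr add0r divfK ?gt_eqF// leNgt => /negP; apply.
  apply: (@lt_le_trans _ _ 0); first by lra.
  by apply: sumr_ge0 => A _; rewrite mulr_ge0// sqnorm_ge0.
have [m [vm stE alpha_le]] := stepsizeP hn p_gt0 v_ge0 v_neq0.
rewrite -alphaE in stE alpha_le.
have alpha_gt0 : 0 < alpha by rewrite stE mulr_gt0 ?ltr0n// divr_gt0.
have xs_min1 : argmin (fun x => (average f x)%:E + psi x)%E xs by rewrite xs_min.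
pose X (b : nat -> {set 'I_n}) i := sgd_star f psi p alpha xs x0 b i.
have X0 b : X b 0 = x0 by [].
have XS b i : X b i.+1 =
  prox alpha psi (X b i - alpha *: star_grad f p xs (b i) (X b i)) by [].
have historyX i w : X (Sk^~ w) i = X (extend (history Sk i w)) i.
  by apply: sgd_star_prefix => l li; rewrite extend_history.
rewrite -[X in (X <= _)%E]/('E_P[fun w => sqnorm (X (Sk^~ w) k - xs)]%E).
clearbody X.
pose E i := \sum_b fine (P [set w | history Sk i w = b]) * sqnorm (X (extend b) i - xs).
have EP i : 'E_P[fun w => sqnorm (X (Sk^~ w) i - xs)]%E = (E i)%:E.
  rewrite -(expectation_finType P (X := history Sk i)
    (F := fun b => sqnorm (X (extend b) i - xs))); last 2 first.
  - by move=> b; exact: measurable_history.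
  - by move=> b; exact: sqnorm_ge0.
  by congr expectation; apply/funext => w; rewrite historyX.
have E_ge0 i : 0 <= E i.
  by apply: sumr_ge0 => b _; rewrite mulr_ge0 ?sqnorm_ge0 ?fine_ge0.
have E_step i : E i.+1 <= (1 - alpha * sigma) * E i.
  pose G (c : {ffun 'I_i -> {set 'I_n}} * {set 'I_n}) :=
    let x := X (extend c.1) i in
    sqnorm (prox alpha psi (x - alpha *: star_grad f p xs c.2 x) - xs).
  have EG : 'E_P[fun w => sqnorm (X (Sk^~ w) i.+1 - xs)]%E =
      'E_P[fun w => G (history Sk i w, Sk i w)]%E.
    by congr expectation; apply/funext => w; rewrite XS /G/= historyX.
  rewrite -lee_fin -EP EG (expectation_history_next Sk_random Sk_indep); last first.
    by move=> c; exact: sqnorm_ge0.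
  rewrite lee_fin mulr_sumr; apply: ler_sum => b _.
  rewrite mulrCA ler_wpM2l ?fine_ge0//.
  (* For a fixed history [b] the iterate is deterministic and the next set has the law [pi], so the
     one-step bound applies. *)
  under eq_bigr do rewrite Sk_copy.
  have := prox_step_contraction hn f_diff f_convex M_sympsd f_smooth f_qsc p_gt0
    pi_ge0 pi_sum1 piE eso alpha_gt0 alpha_le psi_proper psi_closed psi_convex xs_min1
    (X (extend b) i).
  by [].
have E0 : E 0 = sqnorm (x0 - xs).
  apply: EFin_inj; rewrite -EP -(expectation_cst P); congr expectation.
  by apply/funext => w; rewrite X0.
have E_le i : E i <= expR (- (alpha * sigma) * i%:R) * sqnorm (x0 - xs).
  elim: i => [|i IH]; first by rewrite mulr0 expR0 mul1r E0.
  apply: (le_trans (E_step i)); rewrite -natr1 mulrDr mulr1.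
  rewrite expRD [expR _ * expR _]mulrC -mulrA.
  (* As [E i >= 0], the bound [1 - t <= expR (- t)] applies whatever the sign of
     [1 - alpha * sigma]. *)
  apply: (@le_trans _ _ (expR (- (alpha * sigma)) * E i)).
    by rewrite ler_wpM2r// expR_ge1Dx.
  by rewrite ler_wpM2l ?expR_ge0.
rewrite EP lee_fin (le_trans (E_le k))// ler_wpM2r ?sqnorm_ge0//.
move: eps01 => /andP[eps0 eps1].
rewrite -[leRHS]lnK ?posrE// ler_expR mulNr lerNl.
(* At the index [m] attaining the step size, [alpha * sigma] is the inverse of the complexity
   factor. *)
have -> : - ln eps = alpha * sigma * (v m / (n%:R * p m * sigma) * ln (1 / eps)).
  rewrite stE div1r lnV ?posrE// mulrA -[LHS]mul1r; congr (_ * _).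
  have := lt0r_neq0 (p_gt0 m); have := lt0r_neq0 vm; have := lt0r_neq0 sigma_gt0.
  have : n%:R != 0 :> R by rewrite pnatr_eq0 -lt0n.
  by move=> h1 h2 h3 h4; field; rewrite h1 h2 h3 h4.
rewrite ler_wpM2l ?mulr_ge0 ?(ltW alpha_gt0) ?(ltW sigma_gt0)//.
(* The term at [m] may be replaced by the maximum because [ln (1 / eps) >= 0]. *)
apply: le_trans hk; rewrite ler_wpM2r//; last exact: le_bigmax.
by rewrite div1r lnV ?posrE// oppr_ge0 ln_le0// ltW.
Qed.
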